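(* Let $(S,T,m,n)$ be a sesquilaw of a monad $T$ over a monad $S$ on a category $\mathbb{C}$. In the Kleisli magmoid of the magmad $ST$ it induces, let $f\colon X\to STY$, $g\colon Y\to STZ$, $h\colon Z\to STW$. Then the associativity equation $f\mathbin{;}(g\mathbin{;}h)=(f\mathbin{;}g)\mathbin{;}h$ holds if at least one of the following is satisfied: (1) $f=S(\eta^T_Y)\circ u$ for some $u\colon X\to SY$ in $\mathbb{C}$; (2) $g=S(\eta^T_Z)\circ v$ for some $v\colon Y\to SZ$ in $\mathbb{C}$; or (3) $h=\eta^S_{TW}\circ w$ for some $w\colon Z\to TW$ in $\mathbb{C}$.
   Context: For monads $(S,\mu^S,\eta^S)$ and $(T,\mu^T,\eta^T)$ on the same category: A distributive law of $S$ over $T$ is a natural transformation $m_X\colon STX\to TSX$ with $m_X\circ\mu^S_{TX}=T(\mu^S_X)\circ m_{SX}\circ S(m_X)$; $m_X\circ\eta^S_{TX}=T(\eta^S_X)$; $m_X\circ S(\mu^T_X)=\mu^T_{SX}\circ T(m_X)\circ m_{TX}$; $m_X\circ S(\eta^T_X)=\eta^T_{SX}$. An almost-distributive law of $T$ over $S$ is a natural transformation $n_X\colon TSX\to STX$ with $n_X\circ T(\mu^S_X)=\mu^S_{TX}\circ S(n_X)\circ n_{SX}$; $n_X\circ\eta^T_{SX}=S(\eta^T_X)$; $n_X\circ T(\eta^S_X)=\eta^S_{TX}$. A sesquilaw $(S,T,m,n)$ of $T$ over $S$ consists of a distributive law $m\colon ST\to TS$ and an almost-distributive law $n\colon TS\to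 ST$ such that (1) $n_X\circ\mu^T_{SX}\circ T(m_X)=S(\mu^T_X)\circ n_{TX}$ as maps $TSTX\to STX$, and (2) $n_X\circ m_X=\mathrm{id}_{STX}$. The induced magmad (monad without the associativity axiom) is the functor $ST$ with $\mu^{ST}_X=\mu^S_{TX}\circ SS(\mu^T_X)\circ S(n_{TX})$ and $\eta^{ST}_X=S(\eta^T_X)\circ\eta^S_X$. Its Kleisli magmoid has the objects of $\mathbb{C}$, morphisms from $X$ to $Y$ the maps $X\to STY$ in $\mathbb{C}$, identities $\eta^{ST}$, and composition, written in diagrammatic order, $f\mathbin{;}g=\mu^{ST}\circ ST(g)\circ f$. *)

(* Defs.v *)
Set Implicit Arguments.
Unset Strict Implicit.
Unset Printing Implicit Defensive.

(** A magmoid is a category without the associativity axiom.  [comp f g] is in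
    diagrammatic order: first [f], then [g]. *)
Record magmoid : Type := Magmoid {
  Obj :> Type;
  Hom : Obj -> Obj -> Type;
  id_ : forall X : Obj, Hom X X;
  comp : forall X Y Z : Obj, Hom X Y -> Hom Y Z -> Hom X Z;
  comp_idl : forall (X Y : Obj) (f : Hom X Y), comp (id_ X) f = f;
  comp_idr : forall (X Y : Obj) (f : Hom X Y), comp f (id_ Y) = f
}.
Arguments Hom {_} _ _.
Arguments id_ {_} _.
Arguments comp {_ X Y Z} _ _.

Declare Scope cat_scope.
Delimit Scope cat_scope with cat.
Open Scope cat_scope.

Notation "X ~> Y" := (Hom X Y) (at level 90, right associativity) : cat_scope.
Notation "f ⨾[ M ] g" := (@comp M _ _ _ f g)
  (at level 40, left associativity, format "f  ⨾[ M ]  g") : cat_scope.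

Record category : Type := Category {
  cat_magmoid :> magmoid;
  comp_assoc : forall (X Y Z W : cat_magmoid)
    (f : X ~> Y) (g : Y ~> Z) (h : Z ~> W), comp (comp f g) h = comp f (comp g h)
}.
(* Restricted to magmoids underlying a category, so that it is not used for
   composition in a Kleisli magmoid. *)
Notation "g ∘ f" := (@comp (cat_magmoid _) _ _ _ f g)
  (at level 40, left associativity) : cat_scope.

Record functor (C D : category) : Type := Functor {
  fobj :> C -> D;
  fmap : forall X Y : C, (X ~> Y) -> (fobj X ~> fobj Y);
  fmap_id : forall X : C, fmap (id_ X) = id_ (fobj X);
  fmap_comp : forall (X Y Z : C) (f : X ~> Y) (g : Y ~> Z),
    fmap (g ∘ f) = fmap g ∘ fmap f
}.
Arguments fmap {C D} _ {X Y} _.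

Definition functor_id (C : category) : functor C C :=
  {| fobj := fun X : C => X;
     fmap := fun X Y f => f;
     fmap_id := fun X => eq_refl;
     fmap_comp := fun X Y Z f g => eq_refl |}.

Lemma functor_comp_id (C D E : category) (F : functor D E) (G : functor C D)
  (X : C) : fmap F (fmap G (id_ X)) = id_ (F (G X)).
Proof. now rewrite !fmap_id. Qed.

Lemma functor_comp_comp (C D E : category) (F : functor D E) (G : functor C D)
  (X Y Z : C) (f : X ~> Y) (g : Y ~> Z) :
  fmap F (fmap G (g ∘ f)) = fmap F (fmap G g) ∘ fmap F (fmap G f).
Proof. now rewrite !fmap_comp. Qed.

Definition functor_comp (C D E : category) (F : functor D E) (G : functor C D) :
  functor C E :=
  {| fobj := fun X => F (G X);
     fmap := fun X Y f => fmap F (fmap G f);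
     fmap_id := functor_comp_id F G;
     fmap_comp := functor_comp_comp F G |}.
Notation "F ∘F G" := (functor_comp F G)
  (at level 40, left associativity) : cat_scope.

Record nat_trans (C D : category) (F G : functor C D) : Type := NatTrans {
  component :> forall X : C, F X ~> G X;
  naturality : forall (X Y : C) (f : X ~> Y),
    component Y ∘ fmap F f = fmap G f ∘ component X
}.

(** A magmad is a monad without the associativity axiom. *)
Record magmad (C : category) : Type := Magmad {
  magmad_functor :> functor C C;
  mu : nat_trans (magmad_functor ∘F magmad_functor) magmad_functor;
  eta : nat_trans (functor_id C) magmad_functor;
  mu_etal : forall X : C, mu X ∘ eta (magmad_functor X) = id_ (magmad_functor X);
  mu_etar : forall X : C, mu X ∘ fmap magmad_functor (eta X) = id_ (magmad_functor X)
}.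
Arguments mu {C} _.
Arguments eta {C} _.

Record monad (C : category) : Type := Monad {
  monad_magmad :> magmad C;
  mu_assoc : forall X : C,
    mu monad_magmad X ∘ mu monad_magmad (monad_magmad X)
    = mu monad_magmad X ∘ fmap monad_magmad (mu monad_magmad X)
}.

Section Kleisli.
Variables (C : category) (M : magmad C).

Definition kleisli_comp (X Y Z : C) (f : X ~> M Y) (g : Y ~> M Z) : X ~> M Z :=
  mu M Z ∘ fmap M g ∘ f.

Lemma kleisli_idl (X Y : C) (f : X ~> M Y) : kleisli_comp (eta M X) f = f.
Proof.
unfold kleisli_comp; simpl.
pose proof (naturality (eta M) f) as Heta; simpl in Heta.
pose proof (mu_etal M Y) as Hmu; simpl in Hmu.
now rewrite <- comp_assoc, <- Heta, comp_assoc, Hmu, comp_idr.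
Qed.

Lemma kleisli_idr (X Y : C) (f : X ~> M Y) : kleisli_comp f (eta M Y) = f.
Proof. pose proof (mu_etar M Y) as Hmu; simpl in Hmu.
now unfold kleisli_comp; simpl; rewrite Hmu, comp_idr. Qed.

Definition kleisli : magmoid :=
  {| Obj := C;
     Hom := fun X Y => X ~> M Y;
     id_ := eta M;
     comp := kleisli_comp;
     comp_idl := kleisli_idl;
     comp_idr := kleisli_idr |}.
End Kleisli.

(** Distributive law of [S] over [T]. *)
Record dist_law (C : category) (S T : monad C) : Type := DistLaw {
  dl_trans :> nat_trans (S ∘F T) (T ∘F S);
  dl_muS : forall X : C,
    dl_trans X ∘ mu S (T X)
    = fmap T (mu S X) ∘ dl_trans (S X) ∘ fmap S (dl_trans X);
  dl_etaS : forall X : C, dl_trans X ∘ eta S (T X) = fmap T (eta S X);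
  dl_muT : forall X : C,
    dl_trans X ∘ fmap S (mu T X)
    = mu T (S X) ∘ fmap T (dl_trans X) ∘ dl_trans (T X);
  dl_etaT : forall X : C, dl_trans X ∘ fmap S (eta T X) = eta T (S X)
}.

(** Almost-distributive law of [T] over [S]: the axiom for [mu T] is dropped. *)
Record almost_dist_law (C : category) (T S : monad C) : Type := AlmostDistLaw {
  adl_trans :> nat_trans (T ∘F S) (S ∘F T);
  adl_muS : forall X : C,
    adl_trans X ∘ fmap T (mu S X)
    = mu S (T X) ∘ fmap S (adl_trans X) ∘ adl_trans (S X);
  adl_etaT : forall X : C, adl_trans X ∘ eta T (S X) = fmap S (eta T X);
  adl_etaS : forall X : C, adl_trans X ∘ fmap T (eta S X) = eta S (T X)
}.

(** [is_sesquilaw m n]: [(S, T, m, n)] is a sesquilaw of [T] over [S]. *)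
Record is_sesquilaw (C : category) (S T : monad C)
    (m : dist_law S T) (n : almost_dist_law T S) : Prop := IsSesquilaw {
  sesqui_mu : forall X : C,
    n X ∘ mu T (S X) ∘ fmap T (m X) = fmap S (mu T X) ∘ n (T X);
  sesqui_section : forall X : C, n X ∘ m X = id_ (S (T X))
}.

Section InducedMagmad.
Variables (C : category) (S T : monad C) (n : almost_dist_law T S).

Definition induced_mu_component (X : C) : S (T (S (T X))) ~> S (T X) :=
  mu S (T X) ∘ fmap S (fmap S (mu T X)) ∘ fmap S (n (T X)).

Definition induced_eta_component (X : C) : X ~> S (T X) :=
  fmap S (eta T X) ∘ eta S X.

Lemma induced_mu_natural (X Y : C) (f : X ~> Y) :
  induced_mu_component Y ∘ fmap ((S ∘F T) ∘F (S ∘F T)) f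
  = fmap (S ∘F T) f ∘ induced_mu_component X.
Proof.
unfold induced_mu_component; simpl.
rewrite <- !comp_assoc, <- fmap_comp.
pose proof (naturality n (fmap T f)) as Hn; simpl in Hn; rewrite Hn; clear Hn.
rewrite fmap_comp, !comp_assoc; f_equal.
rewrite <- comp_assoc, <- !fmap_comp.
pose proof (naturality (mu T) f) as HT; simpl in HT; rewrite HT.
pose proof (naturality (mu S) (fmap T f)) as HS; simpl in HS.
now rewrite <- HS, !fmap_comp, comp_assoc.
Qed.

Lemma induced_eta_natural (X Y : C) (f : X ~> Y) :
  induced_eta_component Y ∘ fmap (functor_id C) f
  = fmap (S ∘F T) f ∘ induced_eta_component X.
Proof.
unfold induced_eta_component; simpl.
rewrite <- comp_assoc.
pose proof (naturality (eta S) f) as HS; simpl in HS; rewrite HS.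
rewrite !comp_assoc, <- !fmap_comp.
pose proof (naturality (eta T) f) as HT; simpl in HT.
now rewrite HT.
Qed.

Definition induced_mu : nat_trans ((S ∘F T) ∘F (S ∘F T)) (S ∘F T) :=
  @NatTrans _ _ ((S ∘F T) ∘F (S ∘F T)) (S ∘F T)
    induced_mu_component induced_mu_natural.

Definition induced_eta : nat_trans (functor_id C) (S ∘F T) :=
  @NatTrans _ _ (functor_id C) (S ∘F T)
    induced_eta_component induced_eta_natural.

Lemma induced_mu_etal (X : C) :
  induced_mu X ∘ induced_eta ((S ∘F T) X) = id_ ((S ∘F T) X).
Proof.
simpl; unfold induced_mu_component, induced_eta_component; simpl.
pose proof (adl_etaT n (T X)) as Hn; simpl in Hn.
pose proof (mu_etal T X) as HT; simpl in HT.
pose proof (mu_etal S (T X)) as HS; simpl in HS.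
rewrite comp_assoc, <- (comp_assoc (fmap S (eta T (S (T X))))); simpl.
rewrite <- fmap_comp, Hn.
rewrite <- (comp_assoc (fmap S (fmap S (eta T (T X))))); simpl.
rewrite <- !fmap_comp, HT.
now rewrite !fmap_id, comp_idl, HS.
Qed.

Lemma induced_mu_etar (X : C) :
  induced_mu X ∘ fmap (S ∘F T) (induced_eta X) = id_ ((S ∘F T) X).
Proof.
simpl; unfold induced_mu_component, induced_eta_component; simpl.
pose proof (naturality n (eta T X)) as Hn; simpl in Hn.
pose proof (adl_etaS n X) as HnS; simpl in HnS.
pose proof (mu_etar T X) as HT; simpl in HT.
pose proof (mu_etar S (T X)) as HS; simpl in HS.
rewrite <- !comp_assoc, <- !fmap_comp, (fmap_comp T), (comp_assoc _ _ (n (T X))); simpl.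
rewrite Hn, <- comp_assoc, HnS, comp_assoc, <- fmap_comp, HT.
now rewrite fmap_id, comp_idr, HS.
Qed.

Definition induced_magmad_of : magmad C :=
  {| magmad_functor := S ∘F T;
     mu := induced_mu;
     eta := induced_eta;
     mu_etal := induced_mu_etal;
     mu_etar := induced_mu_etar |}.
End InducedMagmad.

Definition induced_magmad (C : category) (S T : monad C)
    (m : dist_law S T) (n : almost_dist_law T S) (_ : is_sesquilaw m n) :
  magmad C := induced_magmad_of n.

(* Main.v *)
Require Import Defs.

(** Write [k^*] for the [S]-Kleisli extension [bind k] of [k : A ~> S B], and
    [φ(g)] for the lift [lift n g], that is [T A ~> T (S (T B)) ~> S (T (T B)) ~> S (T B)]
    for [g : A ~> S (T B)], along the almost-distributive law [n].  Composition in the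
    Kleisli magmoid of [S T] is [f ; g = φ(g)^* ∘ f], so that, by associativity of
    the monad [S],

      [f ; (g ; h) = φ(φ(h)^* ∘ g)^* ∘ f]  and
      [(f ; g) ; h = (φ(h)^* ∘ φ(g))^* ∘ f].

    The equation for all [f] thus says that [φ] respects extension,
    [φ(φ(h)^* ∘ g) = φ(h)^* ∘ φ(g)], which can fail because [n] need not be
    compatible with the multiplication of [T].  Each special case avoids that
    compatibility.

    When [f] factors through the unit of [T], the two lifts are precomposed with
    that unit, and [φ(k) ∘ η = k] makes both sides [φ(h)^* ∘ g^* ∘ u]
    ([pure_comp]).  When [g = S η ∘ v], no multiplication of [T] is needed to lift
    [g], because [φ(g) = n ∘ T v], and compatibility of [n] with the multiplication
    of [S] is enough ([lift_bind]).  When [h = η ∘ w], the extension [φ(h)^*] is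
    just [S] applied to the [T]-Kleisli extension of [w], which commutes with [φ] by
    naturality of [n] and associativity of [T] ([lift_fmap_bind]). *)

(** * Kleisli extension *)

Section Bind.
Variables (C : category) (M : monad C).

Definition bind (A B : C) (k : A ~> M B) : M A ~> M B := mu M B ∘ fmap M k.
Arguments bind {A B} k.

Lemma bind_fmap (A A' B : C) (k : A' ~> M B) (j : A ~> A') :
  bind k ∘ fmap M j = bind (k ∘ j).
Proof. now unfold bind; simpl; rewrite fmap_comp, comp_assoc. Qed.

Lemma fmap_bind (A B B' : C) (j : B ~> B') (k : A ~> M B) :
  fmap M j ∘ bind k = bind (fmap M j ∘ k).
Proof.
unfold bind; rewrite fmap_comp, !comp_assoc.
pose proof (naturality (mu M) j) as H; simpl in H; now rewrite H.
Qed.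

Lemma bind_eta (A B : C) (j : A ~> B) : bind (eta M B ∘ j) = fmap M j.
Proof.
unfold bind; simpl; rewrite fmap_comp, comp_assoc.
pose proof (mu_etar M B) as H; simpl in H; now rewrite H, comp_idr.
Qed.

Lemma bind_mu (B D : C) (k : B ~> M D) :
  bind k ∘ mu M B = mu M D ∘ fmap M (bind k).
Proof.
unfold bind; rewrite fmap_comp, comp_assoc.
pose proof (mu_assoc M D) as Ha; simpl in Ha; rewrite <- Ha.
pose proof (naturality (mu M) k) as Hn; simpl in Hn.
now rewrite <- !comp_assoc, Hn.
Qed.

Lemma bind_bind (A B D : C) (k : B ~> M D) (j : A ~> M B) :
  bind k ∘ bind j = bind (bind k ∘ j).
Proof.
change (bind k ∘ (mu M B ∘ fmap M j) = mu M D ∘ fmap M (bind k ∘ j)).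
pose proof (bind_mu _ _ k) as H; simpl in H; now rewrite fmap_comp, !comp_assoc, H.
Qed.
End Bind.
Arguments bind {C M A B} k.

(** * Lifting along an almost-distributive law *)

Section Lift.
Variables (C : category) (S T : monad C) (n : almost_dist_law T S).

Definition lift (A B : C) (g : A ~> S (T B)) : T A ~> S (T B) :=
  fmap S (mu T B) ∘ n (T B) ∘ fmap T g.
Arguments lift {A B} g.

Lemma kleisli_comp_bind (X Y Z : C) (f : X ~> S (T Y)) (g : Y ~> S (T Z)) :
  kleisli_comp (M := induced_magmad_of n) f g = bind (lift g) ∘ f.
Proof.
unfold kleisli_comp, lift, bind; simpl; unfold induced_mu_component.
now rewrite !fmap_comp, !comp_assoc.
Qed.

(** Both sides are extensions precomposed with [f], so associativity reduces to an
    equation in which [f] does not occur. *)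
Lemma kleisli_comp_assoc_of_lift (X Y Z W : C)
  (f : X ~> S (T Y)) (g : Y ~> S (T Z)) (h : Z ~> S (T W)) :
  lift (bind (lift h) ∘ g) = bind (lift h) ∘ lift g ->
  bind (lift (bind (lift h) ∘ g)) ∘ f = bind (lift h) ∘ (bind (lift g) ∘ f).
Proof. intros H; now rewrite H, <- bind_bind, <- comp_assoc. Qed.

Lemma lift_eta (A B : C) (g : A ~> S (T B)) : lift g ∘ eta T A = g.
Proof.
unfold lift; simpl; rewrite <- comp_assoc.
pose proof (naturality (eta T) g) as He; simpl in He; rewrite <- He.
rewrite comp_assoc, <- (comp_assoc (eta T (S (T B)))); simpl.
pose proof (adl_etaT n (T B)) as Hn; simpl in Hn; rewrite Hn, <- fmap_comp.
pose proof (mu_etal T B) as Hm; simpl in Hm; now rewrite Hm, fmap_id, comp_idr.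
Qed.

(** Following an arrow that factors through the unit of [T], composition is that of
    the Kleisli category of [S], because [lift k] extends [k] along that unit. *)
Lemma pure_comp (X Y Z : C) (u : X ~> S Y) (k : Y ~> S (T Z)) :
  bind (lift k) ∘ (fmap S (eta T Y) ∘ u) = bind k ∘ u.
Proof. now rewrite comp_assoc, bind_fmap, lift_eta. Qed.

(** The multiplication of [T] in the lift cancels the unit in the lifted arrow. *)
Lemma lift_pure (A B : C) (v : A ~> S B) :
  lift (fmap S (eta T B) ∘ v) = n B ∘ fmap T v.
Proof.
unfold lift; simpl; rewrite fmap_comp, comp_assoc.
rewrite <- (comp_assoc (fmap T (fmap S (eta T B)))); simpl.
pose proof (naturality n (eta T B)) as Hn; simpl in Hn.
rewrite Hn, comp_assoc, <- fmap_comp.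
pose proof (mu_etar T B) as Hm; simpl in Hm; now rewrite Hm, fmap_id, comp_idr.
Qed.

(** The compatibility of [n] with the multiplication of [S], in Kleisli form. *)
Lemma lift_bind (A B D : C) (h : B ~> S (T D)) (v : A ~> S B) :
  lift (bind h ∘ v) = bind (lift h) ∘ (n B ∘ fmap T v).
Proof.
unfold lift, bind; rewrite !fmap_comp, !comp_assoc.
rewrite <- (comp_assoc (fmap T (mu S (T D)))); simpl.
pose proof (adl_muS n (T D)) as Hm; simpl in Hm; rewrite Hm, !comp_assoc.
pose proof (naturality (mu S) (mu T D)) as HS; simpl in HS; rewrite <- HS.
rewrite <- (comp_assoc (fmap T (fmap S h))); simpl.
pose proof (naturality n h) as Hn; simpl in Hn; now rewrite Hn, !comp_assoc.
Qed.

Lemma lift_unit (A B : C) (w : A ~> T B) :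
  lift (eta S (T B) ∘ w) = eta S (T B) ∘ bind w.
Proof.
unfold lift, bind; simpl; rewrite fmap_comp, comp_assoc.
rewrite <- (comp_assoc (fmap T (eta S (T B)))); simpl.
pose proof (adl_etaS n (T B)) as Hn; simpl in Hn; rewrite Hn.
pose proof (naturality (eta S) (mu T B)) as He; simpl in He.
now rewrite <- He, !comp_assoc.
Qed.

(** A lift ends with the multiplication of [T], so it commutes with [T]-Kleisli
    extensions by associativity of [T]. *)
Lemma lift_fmap_bind (A B D : C) (w : B ~> T D) (g : A ~> S (T B)) :
  lift (fmap S (bind w) ∘ g) = fmap S (bind w) ∘ lift g.
Proof.
unfold lift; rewrite fmap_comp, !comp_assoc.
rewrite <- (comp_assoc (fmap T (fmap S (bind w)))); simpl.
pose proof (naturality n (bind w)) as Hn; simpl in Hn.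
rewrite Hn, comp_assoc, <- !fmap_comp.
pose proof (bind_mu _ _ _ _ w) as Hb; simpl in Hb; now rewrite Hb.
Qed.
End Lift.
Arguments lift {C S T} n {A B} g.

(** * Associativity *)

Theorem proposition4p9 (C : category) (S T : monad C)
  (m : dist_law S T) (n : almost_dist_law T S) (L : is_sesquilaw m n)
  (X Y Z W : C) (f : X ~> S (T Y)) (g : Y ~> S (T Z)) (h : Z ~> S (T W)) :
  (exists u : X ~> S Y, f = fmap S (eta T Y) ∘ u) \/
  (exists v : Y ~> S Z, g = fmap S (eta T Z) ∘ v) \/
  (exists w : Z ~> T W, h = eta S (T W) ∘ w) ->
  f ⨾[kleisli (induced_magmad L)] (g ⨾[kleisli (induced_magmad L)] h)
  = (f ⨾[kleisli (induced_magmad L)] g) ⨾[kleisli (induced_magmad L)] h.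
Proof.
intros H.
change (kleisli_comp (M := induced_magmad_of n) f
          (kleisli_comp (M := induced_magmad_of n) g h)
        = kleisli_comp (M := induced_magmad_of n)
          (kleisli_comp (M := induced_magmad_of n) f g) h).
rewrite !kleisli_comp_bind.
destruct H as [[u ->] | [[v ->] | [w ->]]].
- now rewrite !pure_comp, comp_assoc, bind_bind.
- apply kleisli_comp_assoc_of_lift.
  now rewrite pure_comp, lift_bind, lift_pure.
- apply kleisli_comp_assoc_of_lift.
  now rewrite lift_unit, bind_eta, lift_fmap_bind.
Qed.
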